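(* Let $d \ge 1$, $c \ge 2$ be integers, let $\sigma > 0$, let $g : \mathbb{R}^d \to [0,1]^c$, and let $\overline{h} : \mathbb{R}^d \to [0,1]^c$ be measurable. Suppose that for every $i \in [c]$ the component $\overline{h}_i$ is neither equal to $0$ almost everywhere nor equal to $1$ almost everywhere (with respect to Lebesgue measure). Let $h : \mathbb{R}^d \to [0,1]^c$ be the Gaussian randomized smoothing classifier $$h(x) = \mathbb{E}_{\xi \sim \mathcal{N}(0, \sigma^2 I_d)}\big[\overline{h}(x + \xi)\big], \quad x \in \mathbb{R}^d.$$ Let $x \in \mathbb{R}^d$ be arbitrary, let $y = \arg\max_{i \in [c]} h_i(x)$ and $y' = \arg\max_{i \ne y} h_i(x)$. Let $\alpha \in [\frac12, 1]$ and let $h^\alpha$ be the mixed classifier, $h_i^\alpha(\cdot) = \log\big((1-\alpha) g_i(\cdot) + \alpha h_i(\cdot)\big)$. Then $\arg\max_{i \in [c]} h_i^\alpha(x+\delta) = y$, in the sense that $h_y^\alpha(x+\delta) \ge h_i^\alpha(x+\delta)$ for all $i \in [c]$, for every $\delta \in \mathbb{R}^d$ such that $$\|\delta\|_2 \le r_\sigma^\alpha(x) := \frac{\sigma}{2}\Big(\Phi^{-1}\big(\alpha h_y(x)\big) - \Phi^{-1}\big(\alpha h_{y'}(x) + 1 - \alpha\big)\Big).$$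
   Context: Notation: $[c] = \{1, 2, \dots, c\}$; $\|\cdot\|_2$ is the Euclidean norm; $I_d$ is the $d \times d$ identity matrix; $\mathcal{N}(0, \sigma^2 I_d)$ is the centered Gaussian distribution on $\mathbb{R}^d$ with covariance $\sigma^2 I_d$; $\Phi$ is the cumulative distribution function of $\mathcal{N}(0,1)$ on $\mathbb{R}$ and $\Phi^{-1} : (0,1) \to \mathbb{R}$ is its inverse. The function $g$ (the standard base classifier) outputs class probabilities, so $0 \le g_i(\cdot) \le 1$ for all $i$; no other assumption is made on $g$. Convention on argmax: $y = \arg\max_i a_i$ means that the index $y$ attains the maximum, i.e. $a_y \ge a_i$ for all $i$ in the index set (ties are allowed). If $r_\sigma^\alpha(x) < 0$ the assertion is vacuous. *)

(* Defs.v *)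
From HB Require Import structures.
From mathcomp Require Import all_boot all_order all_algebra.
From mathcomp Require Import all_classical all_reals all_analysis.

Set Implicit Arguments.
Unset Strict Implicit.
Unset Printing Implicit Defensive.
Import Order.TTheory GRing.Theory Num.Theory.
Import numFieldNormedType.Exports.
Local Open Scope classical_set_scope.
Local Open Scope ring_scope.

(* The sigma-algebra on R^n is the product of n copies of the Borel
   sigma-algebra of R (it is generated by the coordinate functions), in the
   same way as the library does for n.-tuple; it is the Borel sigma-algebra
   of R^n. *)
Section measurable_rV.
Context {R : realType} (n : nat).

Let coors : 'I_n -> 'rV[R]_n -> measurableTypeR R := fun i v => v ord0 i.

Let rV_set0 : g_sigma_preimage coors set0.
Proof. exact: sigma_algebra0. Qed.

Let rV_setC A : g_sigma_preimage coors A -> g_sigma_preimage coors (~` A).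
Proof. exact: sigma_algebraC. Qed.

Let rV_bigcup (F : _^nat) : (forall i, g_sigma_preimage coors (F i)) ->
  g_sigma_preimage coors (\bigcup_i (F i)).
Proof. exact: sigma_algebra_bigcup. Qed.

HB.instance Definition _ := @isMeasurable.Build default_measure_display
  'rV[R]_n (g_sigma_preimage coors) rV_set0 rV_setC rV_bigcup.

Lemma measurable_coord (i : 'I_n) :
  measurable_fun [set: 'rV[R]_n] (fun v => v ord0 i : measurableTypeR R).
Proof.
move=> _ Y mY; rewrite setTI; apply: sub_sigma_algebra => /=.
rewrite -bigcup_seq/=; exists i => /=; first by rewrite mem_index_enum.
by exists Y => //; rewrite setTI.
Qed.

Lemma measurable_fun_rVP d (T : measurableType d) (f : T -> 'rV[R]_n) :
  measurable_fun [set: T] f <->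
  forall i, measurable_fun [set: T] (fun x => f x ord0 i : measurableTypeR R).
Proof.
split=> [mf i|mf]; first exact: (measurableT_comp (measurable_coord i) mf).
suff H : g_sigma_preimage (fun i => coors i \o f) `<=` measurable.
  move=> _ A mA; apply: H.
  by rewrite g_sigma_preimage_comp; exists A.
apply: smallest_sub; first exact: sigma_algebra_measurable.
rewrite -bigcup_seq => A [i _] [B mB <-].
exact: mf.
Qed.

End measurable_rV.

Definition rV_cons {R : realType} (n : nat)
    (p : measurableTypeR R * 'rV[R]_n) : 'rV[R]_n.+1 :=
  row_mx (const_mx p.1 : 'rV[R]_1) p.2.

(* mu \x ... \x mu (n factors), transported to row vectors along rV_cons. *)
Fixpoint power_measure {R : realType} (mu : set (measurableTypeR R) -> \bar R)
    (n : nat) : set 'rV[R]_n -> \bar R :=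
  if n is n'.+1 then pushforward (mu \x @power_measure R mu n')%E (@rV_cons R n')
  else dirac (0 : 'rV[R]_0).
Arguments power_measure {R} mu n _ : simpl nomatch.

Section power_measure_instances.
Context {R : realType}.

Lemma rV_cons0 n (p : measurableTypeR R * 'rV[R]_n) :
  rV_cons p ord0 ord0 = p.1.
Proof.
have -> : (ord0 : 'I_(1 + n)) = lshift n ord0 by exact: val_inj.
by apply: etrans (row_mxEl _ _ _ _) _; rewrite mxE.
Qed.

Lemma rV_consS n (p : measurableTypeR R * 'rV[R]_n) i :
  rV_cons p ord0 (lift ord0 i) = p.2 ord0 i.
Proof.
have -> : (lift ord0 i : 'I_(1 + n)) = rshift 1 i by exact: val_inj.
exact: row_mxEr.
Qed.

Lemma measurable_rV_cons n : measurable_fun setT (@rV_cons R n).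
Proof.
apply/measurable_fun_rVP => i; have [j ->|->] := unliftP ord0 i.
  under eq_fun do rewrite rV_consS.
  exact: (measurableT_comp (measurable_coord j) measurable_snd).
under eq_fun do rewrite rV_cons0.
exact: measurable_fst.
Qed.

Definition rV_uncons n (v : 'rV[R]_n.+1) : measurableTypeR R * 'rV[R]_n :=
  (v ord0 ord0, \row_i v ord0 (lift ord0 i)).

Lemma rV_consK n : cancel (@rV_cons R n) (@rV_uncons n).
Proof.
move=> p; rewrite /rV_uncons rV_cons0 [RHS]surjective_pairing; congr pair.
by apply/rowP => i; rewrite mxE rV_consS.
Qed.

Lemma measurable_rV_uncons n : measurable_fun setT (@rV_uncons n).
Proof.
apply/measurable_fun_pairP; split=> /=.
  exact: measurable_coord.
apply/measurable_fun_rVP => i.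
under eq_fun do rewrite mxE.
exact: measurable_coord.
Qed.

Section rV_cons_measure.
Variable n : nat.
Variables (mu : {sigma_finite_measure set (measurableTypeR R) -> \bar R})
  (m : {sigma_finite_measure set 'rV[R]_n -> \bar R}).

Let nu := pushforward (mu \x m)%E (@rV_cons R n).

Let nu0 : nu set0 = 0%E. Proof. by rewrite /nu /pushforward preimage_set0. Qed.

Let nu_ge0 A : (0 <= nu A)%E.
Proof. exact: (measure_ge0 (mu \x m)%E). Qed.

Let nu_sigma_additive : semi_sigma_additive nu.
Proof.
move=> F mF tF mUF; rewrite /nu /pushforward preimage_bigcup.
have mcons A : measurable A -> measurable (@rV_cons R n @^-1` A).
  by move=> mA; rewrite -[X in measurable X]setTI; exact: measurable_rV_cons.
apply: (measure_semi_sigma_additive (s := (mu \x m)%E)).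
- by move=> k; exact: mcons.
- apply/trivIsetP => /= i j _ _ ij; rewrite -preimage_setI.
  by move/trivIsetP : tF => /(_ _ _ _ _ ij) ->//; rewrite preimage_set0.
- by rewrite -preimage_bigcup; exact: mcons.
Qed.

HB.instance Definition _ := isMeasure.Build _ _ _ nu
  nu0 nu_ge0 nu_sigma_additive.

Let nu_sigma_finite : sigma_finite setT nu.
Proof.
have /sigma_finiteP[F [TF ndF Foo]] := sigma_finiteT mu.
have /sigma_finiteP[G [TG ndG Goo]] := sigma_finiteT m.
exists (fun k => @rV_uncons n @^-1` (F k `*` G k)) => [|k].
  rewrite -preimage_bigcup -[LHS](preimage_setT (@rV_uncons n)).
  congr (_ @^-1` _); rewrite -setXTT TF TG predeqE => -[u v]; split.
    move=> [/= [k _ Fku] [l _ Glv]]; exists (maxn k l) => //; split.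
    - by move: u Fku; exact/subsetPset/ndF/leq_maxl.
    - by move: v Glv; exact/subsetPset/ndG/leq_maxr.
  by move=> [k _ [/= ? ?]]; split; exists k.
have [mF Fk] := Foo k; have [mG Gk] := Goo k.
split.
  rewrite -[X in measurable X]setTI; apply: measurable_rV_uncons => //.
  exact: measurableX.
rewrite /nu /pushforward (_ : _ @^-1` _ = F k `*` G k).
  by rewrite (product_measure1E mu m)// lte_mul_pinfty// ge0_fin_numE.
by rewrite -comp_preimage (_ : _ \o _ = id)//; apply/funext/rV_consK.
Qed.

HB.instance Definition _ := Measure_isSigmaFinite.Build _ _ _ nu
  nu_sigma_finite.

Definition rV_cons_measure : {sigma_finite_measure set 'rV[R]_n.+1 -> \bar R} :=
  nu.

End rV_cons_measure.

Section power_sigma_finite.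
Variables (mu : {sigma_finite_measure set (measurableTypeR R) -> \bar R}).
Variable n : nat.

Lemma power_measure_bundle :
  exists m : {sigma_finite_measure set 'rV[R]_n -> \bar R},
    m = power_measure mu n :> (set _ -> \bar R).
Proof.
elim: n => [|k [m /= <-]]; first by exists (dirac (0 : 'rV[R]_0)).
by exists (rV_cons_measure mu m).
Qed.

Let pow0 : power_measure mu n set0 = 0%E.
Proof. by have [m <-] := power_measure_bundle. Qed.

Let pow_ge0 A : (0 <= power_measure mu n A)%E.
Proof. by have [m <-] := power_measure_bundle. Qed.

Let pow_sigma_additive : semi_sigma_additive (power_measure mu n).
Proof.
by have [m <-] := power_measure_bundle; exact: measure_semi_sigma_additive.
Qed.

HB.instance Definition _ := isMeasure.Build _ _ _ (power_measure mu n)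
  pow0 pow_ge0 pow_sigma_additive.

Let pow_sigma_finite : sigma_finite setT (power_measure mu n).
Proof. by have [m <-] := power_measure_bundle; exact: sigma_finiteT. Qed.

HB.instance Definition _ := Measure_isSigmaFinite.Build _ _ _
  (power_measure mu n) pow_sigma_finite.

End power_sigma_finite.

Lemma power_measureT (P : probability (measurableTypeR R) R) n :
  power_measure P n setT = 1%E.
Proof.
elim: n => [|n IHn]; first by rewrite /= diracT.
rewrite /= /pushforward preimage_setT -setXTT.
rewrite (product_measure1E P (power_measure P n))//.
rewrite -[RHS]mule1; congr (_ * _)%E; last exact: IHn.
exact: probability_setT.
Qed.

End power_measure_instances.

Definition lebesgue_rV {R : realType} (n : nat) : set 'rV[R]_n -> \bar R :=
  power_measure lebesgue_measure n.
Arguments lebesgue_rV {R} n _.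

HB.instance Definition _ (R : realType) n :=
  SigmaFiniteMeasure.on (@lebesgue_rV R n).

(* N(0, s^2 I_n): the coordinates are independent with law N(0, s^2). As in
   normal_prob, the parameter s is the standard deviation. *)
Definition gaussian {R : realType} (s : R) (n : nat) : set 'rV[R]_n -> \bar R :=
  power_measure (normal_prob 0 s) n.
Arguments gaussian {R} s n _.

HB.instance Definition _ (R : realType) (s : R) n :=
  Measure.on (gaussian s n).

HB.instance Definition _ (R : realType) (s : R) n :=
  Measure_isProbability.Build _ _ _ (gaussian s n)
    (power_measureT (normal_prob 0 s) n).

(* The library norm `|v| on row vectors is the sup norm. *)
Definition l2norm {R : realType} n (v : 'rV[R]_n) : R :=
  Num.sqrt (\sum_(i < n) v ord0 i ^+ 2).

Definition Phi {R : realType} (t : R) : R :=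
  fine (normal_prob 0 1 `]-oo, t]).

(* The inverse of Phi on its range, which is ]0, 1[; the value is 0 elsewhere.
   *)
Definition Phi_inv {R : realType} : R -> R := 'pinv_(fun=> 0) setT Phi.

(* A predicate on y rather than a choice of index: ties are allowed. *)
Definition is_argmax {R : realType} c (P : pred 'I_c) (v : 'rV[R]_c)
    (y : 'I_c) : Prop :=
  P y /\ forall i, P i -> v ord0 i <= v ord0 y.

Definition unit_valued {R : realType} d c (f : 'rV[R]_d -> 'rV[R]_c) : Prop :=
  forall z i, 0 <= f z ord0 i <= 1.

Definition smoothed {R : realType} (s : R) d c (hbar : 'rV[R]_d -> 'rV[R]_c)
    (x : 'rV[R]_d) : 'rV[R]_c :=
  \row_i fine 'E_(gaussian s d)[fun xi => hbar (x + xi) ord0 i].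

(* The library sets ln 0 = 0. This value does not occur when 0 < a and the
   entries of h are positive. *)
Definition mixed {R : realType} (a : R) d c (g h : 'rV[R]_d -> 'rV[R]_c)
    (x : 'rV[R]_d) : 'rV[R]_c :=
  \row_i ln ((1 - a) * g x ord0 i + a * h x ord0 i).

Definition certified_radius {R : realType} (s a : R) d c
    (h : 'rV[R]_d -> 'rV[R]_c) (x : 'rV[R]_d) (y y' : 'I_c) : R :=
  s / 2 * (Phi_inv (a * h x ord0 y) - Phi_inv (a * h x ord0 y' + 1 - a)).

(* Main.v *)
Require Import Defs.
From HB Require Import structures.
From mathcomp Require Import all_boot all_order all_algebra.
From mathcomp Require Import all_classical all_reals all_analysis.
From mathcomp Require Import measurable_realfun ring lra.

Set Implicit Arguments.
Unset Strict Implicit.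
Unset Printing Implicit Defensive.
Import Order.TTheory GRing.Theory Num.Theory.
Import numFieldNormedType.Exports.
Local Open Scope classical_set_scope.
Local Open Scope ring_scope.

(** For measurable [F] with values in [[0, 1]], the average
    [z |-> E F(z + xi)], composed with the inverse of [Phi], is
    [1 / sigma]-Lipschitz: the Neyman-Pearson lemma says that, among the [F]
    with a given average at [x], the average at [x + delta] is extremal for the
    indicator of a half-space orthogonal to [delta], and the Gaussian measure of
    half-spaces is explicit in terms of [Phi].  Applied to [alpha hbar_y] and to
    [alpha hbar_i + 1 - alpha], this gives
    [alpha h_y >= alpha h_i + 1 - alpha] on the certified ball, which absorbs
    any contribution of [g]. *)

(** * Normal laws on the line: affine changes of variable, convolution, translation *)

Section one_dimension.
Context {R : realType}.
Local Notation mu := (@lebesgue_measure R).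

Lemma measurable_affine (k b : R) :
  measurable_fun setT (fun u : measurableTypeR R => k * u + b : measurableTypeR R).
Proof. exact: measurable_funD. Qed.

(** The Radon-Nikodym derivative of the normal law and [normal_pdf] have the same integral over
    every measurable set, so they agree almost everywhere and either one may serve as the weight. *)
Lemma ge0_integral_normal_prob (m s : R) (f : measurableTypeR R -> \bar R) :
  measurable_fun setT f -> (forall u, (0 <= f u)%E) ->
  (\int[normal_prob m s]_u f u = \int[mu]_u (f u * (normal_pdf m s u)%:E))%E.
Proof.
move=> mf f0.
rewrite -(Radon_Nikodym_SigmaFinite.change_of_variables (normal_prob_dominates m s))//=.
have mpdf : measurable_fun setT (EFin \o normal_pdf m s).
  by apply/measurable_EFinP; exact: measurable_normal_pdf.
have intRN := Radon_Nikodym_SigmaFinite.f_integrable (normal_prob_dominates m s).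
apply: ae_eq_integral => //.
- by apply: emeasurable_funM => //; exact: (measurable_int mu).
- exact: emeasurable_funM.
- apply: ae_eqe_mul2l => /=; apply: integral_ae_eq => //=.
  move=> E _ mE.
  by rewrite -Radon_Nikodym_SigmaFinite.f_integral//; exact: normal_prob_dominates.
Qed.

(** By uniqueness of Lebesgue measure it suffices that the pushforward under the affine map, scaled
    by [|k|], gives each interval []a, c]] its length. *)
Lemma lebesgue_measure_affine (k b : R) (A : set (measurableTypeR R)) : k != 0 ->
  measurable A ->
  mu A = (`|k|%:E * mu ((fun u : measurableTypeR R => (k * u + b)%R) @^-1` A))%E.
Proof.
move=> k0 mA.
have nk : 0 <= `|k| by [].
pose nu : {measure set _ -> \bar R} :=
  measure_function_pushforward__canonical__measure_function_Measure
    mu (measurable_affine k b).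
rewrite -[RHS]/(mscale (NngNum nk) nu A).
apply: lebesgue_measure_unique => //.
move=> _ [[a c]] _ <-; 
rewrite -[RHS]/(`|k|%:E * mu ((fun u : R => (k * u + b)%R) @^-1` `]a, c]))%E.
have [k_gt0|k_lt0|k_eq0] := ltgtP 0 k; last by rewrite -k_eq0 eqxx in k0.
  rewrite (_ : _ @^-1` _ = `](a - b) / k, (c - b) / k]%classic).
    rewrite !lebesgue_measure_itv/= !lte_fin ltr_pM2r ?invr_gt0// ltrD2r.
    case: ifPn => // _; last by rewrite mule0.
    rewrite gtr0_norm// -!EFinD -EFinM; congr EFin; field; exact: lt0r_neq0.
  apply/seteqP; split => u /=; rewrite !in_itv/= ltr_pdivrMr// ler_pdivlMr//;
    by rewrite ltrBlDr lerBrDr (mulrC k).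
(* For [k < 0] the map reverses order, so the preimage is closed on the left and open on the right;
   its length is unaffected. *)
rewrite (_ : _ @^-1` _ = `[(c - b) / k, (a - b) / k[%classic).
  rewrite !lebesgue_measure_itv/= !lte_fin ltr_nM2r ?invr_lt0// ltrD2r.
  case: ifPn => // _; last by rewrite mule0.
  by rewrite ltr0_norm// -!EFinD -EFinM; congr EFin; field.
apply/seteqP; split => u /=; rewrite !in_itv/= ltr_ndivlMr// ler_ndivrMr//;
  by rewrite lerBrDr ltrBlDr (mulrC k) andbC.
Qed.

Lemma ge0_integral_affine (k b : R) (f : measurableTypeR R -> \bar R) : k != 0 ->
  measurable_fun setT f -> (forall u, (0 <= f u)%E) ->
  (\int[mu]_u f u = `|k|%:E * \int[mu]_u f (k * u + b)%R)%E.
Proof.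
move=> k0 mf f0.
have nk : 0 <= `|k| by [].
pose F := (fun u : measurableTypeR R => k * u + b : measurableTypeR R).
have mF : measurable_fun setT F := measurable_affine k b.
have -> : (\int[mu]_u f (k * u + b)%R = \int[pushforward mu F]_u f u)%E.
  by rewrite ge0_integral_pushforward// preimage_setT.
pose nu : {measure set _ -> \bar R} :=
  measure_function_pushforward__canonical__measure_function_Measure mu mF.
transitivity (\int[mscale (NngNum nk) nu]_u f u)%E.
  by apply: eq_measure_integral => // A mA _; exact: lebesgue_measure_affine.
by rewrite ge0_integral_mscale.
Qed.

Lemma normal_pdf_affine (m s k b u : R) : s != 0 -> k != 0 ->
  normal_pdf m s u = `|k| * normal_pdf (k * m + b) (k * s) (k * u + b).
Proof.
move=> s0 k0; rewrite !normal_pdfE ?mulf_neq0// /normal_peak /normal_fun.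
rewrite mulrA; congr (_ * expR _); last by field; rewrite s0 k0.
have -> : (k * s) ^+ 2 * pi *+ 2 = k ^+ 2 * (s ^+ 2 * pi *+ 2) by ring.
by rewrite sqrtrM ?sqr_ge0// sqrtr_sqr invfM mulrA divff ?normr_eq0// mul1r.
Qed.

Lemma ge0_integral_normal_prob_affine (m s k b : R) (f : measurableTypeR R -> \bar R) :
  s != 0 -> k != 0 ->
  measurable_fun setT f -> (forall u, (0 <= f u)%E) ->
  (\int[normal_prob m s]_u f (k * u + b)%R =
   \int[normal_prob (k * m + b) (k * s)]_u f u)%E.
Proof.
move=> s0 k0 mf f0.
rewrite [LHS]ge0_integral_normal_prob//; last first.
  exact: (measurableT_comp mf (measurable_affine k b)).
rewrite [RHS]ge0_integral_normal_prob; [|exact: mf|exact: f0].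
have mpdf m' s' : measurable_fun setT (EFin \o @normal_pdf R m' s').
  by apply/measurable_EFinP; exact: measurable_normal_pdf.
rewrite [RHS](ge0_integral_affine b k0); last 2 first.
- exact: (emeasurable_funM mf (mpdf _ _)).
- by move=> u; rewrite mule_ge0// lee_fin normal_pdf_ge0.
rewrite -ge0_integralZl//; last 2 first.
- apply: (measurableT_comp (f := fun v => (f v * (normal_pdf (k * m + b) (k * s) v)%:E)%E) _ (measurable_affine k b)).
  exact: (emeasurable_funM mf (mpdf _ _)).
- by move=> u _; rewrite mule_ge0// lee_fin normal_pdf_ge0.
by apply: eq_integral => u _; rewrite (@normal_pdf_affine _ _ k b)// EFinM muleCA.
Qed.

Lemma normal_probE (m s : R) (A : set (measurableTypeR R)) : measurable A ->
  normal_prob m s A = (\int[normal_prob m s]_u (\1_A u)%:E)%E.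
Proof. by move=> mA; rewrite integral_indic// setIT. Qed.

Lemma normal_prob_affine (m s k b : R) (A : set (measurableTypeR R)) :
  s != 0 -> k != 0 -> measurable A ->
  normal_prob m s ((fun u => k * u + b) @^-1` A) = normal_prob (k * m + b) (k * s) A.
Proof.
move=> s0 k0 mA; rewrite [LHS]normal_probE; last first.
  by have := measurable_affine k b; move=> /(_ measurableT _ mA); rewrite setTI.
rewrite [RHS]normal_probE; last exact: mA.
have m1A : measurable_fun setT (fun w : measurableTypeR R => (\1_A w)%:E : \bar R).
  exact/measurable_EFinP/measurable_indic.
apply: (ge0_integral_normal_prob_affine m b s0 k0 m1A).
by move=> u; rewrite lee_fin.
Qed.

(* Completing the square in [u]. *)
Lemma normal_pdfM (s t u w : R) : s != 0 -> t != 0 ->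
  let q := Num.sqrt (s ^+ 2 + t ^+ 2) in
  normal_pdf 0 s u * normal_pdf u t w =
  normal_pdf 0 q w * normal_pdf (s ^+ 2 * w / q ^+ 2) (s * t / q) u.
Proof.
move=> s0 t0 q.
have s2 : 0 < s ^+ 2 by rewrite exprn_even_gt0.
have t2 : 0 < t ^+ 2 by rewrite exprn_even_gt0.
have q2 : q ^+ 2 = s ^+ 2 + t ^+ 2 by rewrite sqr_sqrtr// addr_ge0// ltW.
have q0 : q != 0 by rewrite sqrtr_eq0 -ltNge addr_gt0.
rewrite !normal_pdfE ?mulf_neq0 ?invr_eq0// /normal_peak /normal_fun.
rewrite mulrACA -expRD [RHS]mulrACA -expRD; congr (_ * expR _).
  have h (a : R) : 0 <= a ^+ 2 * pi *+ 2.
    by rewrite mulrn_wge0// mulr_ge0 ?pi_ge0 ?sqr_ge0.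
  rewrite -!invfM -!sqrtrM//.
  by congr (Num.sqrt _)^-1; field.
have qq0 : s ^+ 2 + t ^+ 2 != 0 by rewrite -q2 expf_neq0.
have -> : (s * t / q) ^+ 2 = s ^+ 2 * t ^+ 2 / q ^+ 2 by field.
rewrite q2; field.
by rewrite s0 t0 qq0.
Qed.

(** The mean and the point are taken as one pair, so that joint measurability holds and Tonelli
    applies when the mean is itself random. *)
Let normal_kernel t (A : set (measurableTypeR R))
    (z : measurableTypeR R * measurableTypeR R) : \bar R :=
  ((\1_A z.2)%:E * (normal_pdf z.1 t z.2)%:E)%E.

Let normal_kernel_ge0 t A z : (0 <= normal_kernel t A z)%E.
Proof. by rewrite mule_ge0// lee_fin// normal_pdf_ge0. Qed.

Let measurable_normal_kernel t A : t != 0 -> measurable A ->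
  measurable_fun setT (normal_kernel t A).
Proof.
move=> t0 mA.
have m1A : measurable_fun setT (fun w : measurableTypeR R => (\1_A w)%:E : \bar R).
  exact/measurable_EFinP/measurable_indic.
apply: emeasurable_funM; first exact: (measurableT_comp m1A measurable_snd).
apply/measurable_EFinP; under eq_fun do rewrite normal_pdfE//.
apply: measurable_funM => //; apply: measurableT_comp => //.
apply: measurable_funM => //; apply: measurableT_comp => //.
by apply: measurable_funX; exact: measurable_funB.
Qed.

Let normal_prob_kernelE t A u : measurable A ->
  normal_prob u t A = (\int[mu]_w normal_kernel t A (u, w))%E.
Proof.
move=> mA; have m1A : measurable_fun setT (fun w : measurableTypeR R => (\1_A w)%:E : \bar R).
  exact/measurable_EFinP/measurable_indic.
rewrite normal_probE; last exact: mA.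
by rewrite ge0_integral_normal_prob; [by []|exact: m1A|by move=> w; rewrite lee_fin].
Qed.

Lemma measurable_normal_prob t A : t != 0 -> measurable A ->
  measurable_fun setT (fun u : measurableTypeR R => normal_prob u t A).
Proof.
move=> t0 mA; under eq_fun do rewrite normal_prob_kernelE//.
exact: (measurable_fun_fubini_tonelli_F _ (measurable_normal_kernel t0 mA)).
Qed.

(** This is the convolution of two centered normal laws: after exchanging the integrals, the mean
    [u] is integrated out first. *)
Lemma normal_prob_mixture (s t : R) (A : set (measurableTypeR R)) :
  s != 0 -> t != 0 -> measurable A ->
  (\int[normal_prob 0 s]_u normal_prob u t A =
   normal_prob 0 (Num.sqrt (s ^+ 2 + t ^+ 2)) A)%E.
Proof.
move=> s0 t0 mA; set q := Num.sqrt _.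
have mpdf m r : measurable_fun setT (EFin \o @normal_pdf R m r).
  by apply/measurable_EFinP; exact: measurable_normal_pdf.
have m1A : measurable_fun setT (fun w : measurableTypeR R => (\1_A w)%:E : \bar R).
  exact/measurable_EFinP/measurable_indic.
pose H := normal_kernel t A.
have H0 z : (0 <= H z)%E by exact: normal_kernel_ge0.
have mH : measurable_fun setT H by exact: measurable_normal_kernel.
have NH u : normal_prob u t A = (\int[mu]_w H (u, w))%E by exact: normal_prob_kernelE.
have mN := measurable_normal_prob t0 mA.
rewrite ge0_integral_normal_prob; last 2 first.
- exact: mN.
- by move=> u; rewrite measure_ge0.
pose G (z : measurableTypeR R * measurableTypeR R) :=
  (H z * (normal_pdf 0 s z.1)%:E)%E.
have G0 z : (0 <= G z)%E by rewrite mule_ge0// lee_fin// normal_pdf_ge0.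
have mG : measurable_fun setT G.
  apply: emeasurable_funM => //.
  exact: (measurableT_comp (mpdf _ _) measurable_fst).
transitivity (\int[mu]_u \int[mu]_w G (u, w))%E.
  apply: eq_integral => u _; rewrite NH -ge0_integralZr//; last first.
    by rewrite lee_fin normal_pdf_ge0.
  exact: (measurableT_comp mH (pair1_measurable u)).
transitivity (\int[mu]_w \int[mu]_u G (u, w))%E.
  exact: (fubini_tonelli G mG G0).
rewrite [RHS]normal_probE; last exact: mA.
rewrite [RHS]ge0_integral_normal_prob; last 2 first.
- exact: m1A.
- by move=> w; rewrite lee_fin.
apply: eq_integral => w _.
(* By [normal_pdfM], [u] now occurs only in a normal density, whose integral is 1. *)
transitivity (\int[mu]_u (((\1_A w)%:E * (normal_pdf 0 q w)%:E) *
    (normal_pdf (s ^+ 2 * w / q ^+ 2) (s * t / q) u)%:E))%E.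
  apply: eq_integral => u _; rewrite /G /H/= -!EFinM; congr EFin.
  have := normal_pdfM u w s0 t0; rewrite /= -/q => pdfM.
  by rewrite -mulrA -[RHS]mulrA -pdfM [X in _ * X = _]mulrC.
rewrite ge0_integralZl//.
- rewrite [X in (_ * X)%E](_ : _ = 1%E) ?mule1//; exact: integral_normal_pdf.
- exact: mpdf.
- by move=> u _; rewrite lee_fin normal_pdf_ge0.
- by rewrite mule_ge0// lee_fin// normal_pdf_ge0.
Qed.

(** The exponential is the quotient of the densities of N(a, s^2) and N(0, s^2). This is the
    one-dimensional case of the Cameron-Martin formula. *)
Lemma ge0_integral_normal_prob_shift (s a : R) (f : measurableTypeR R -> \bar R) :
  s != 0 -> measurable_fun setT f -> (forall u, (0 <= f u)%E) ->
  (\int[normal_prob 0 s]_u f (u + a)%R =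
   \int[normal_prob 0 s]_u (f u * (expR ((a * u - a ^+ 2 / 2) / s ^+ 2))%:E))%E.
Proof.
move=> s0 mf f0.
transitivity (\int[normal_prob a s]_u f u)%E.
  have := ge0_integral_normal_prob_affine 0 a s0 (oner_neq0 R) mf f0.
  rewrite mulr0 add0r mul1r => <-.
  by apply: eq_integral => u _; rewrite mul1r.
have mL : measurable_fun setT (fun u : measurableTypeR R =>
    (expR ((a * u - a ^+ 2 / 2) / s ^+ 2))%:E).
  apply/measurable_EFinP; apply: measurableT_comp => //.
  apply: measurable_funM => //; exact: measurable_affine.
rewrite [LHS]ge0_integral_normal_prob; [|exact: mf|exact: f0].
rewrite [RHS]ge0_integral_normal_prob; last 2 first.
- exact: (emeasurable_funM mf mL).
- by move=> u; rewrite mule_ge0// lee_fin expR_ge0.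
apply: eq_integral => u _; rewrite -muleA -EFinM; congr (_ * _%:E)%E.
rewrite !normal_pdfE// /normal_fun mulrCA -expRD; congr (_ * expR _).
by field.
Qed.

End one_dimension.

(** * The standard normal distribution function and its inverse *)

Section standard_normal_cdf.
Context {R : realType}.

Lemma EFin_Phi (t : R) : normal_prob 0 1 `]-oo, t] = (Phi t)%:E.
Proof. by rewrite /Phi fineK// fin_num_measure. Qed.

Lemma normal_prob_ray (s t : R) : 0 < s ->
  normal_prob 0 s `]-oo, t] = (Phi (t / s))%:E.
Proof.
move=> s0; rewrite -EFin_Phi.
have := @normal_prob_affine R 0 1 s 0 `]-oo, t] (oner_neq0 R) (lt0r_neq0 s0).
rewrite mulr0 addr0 mulr1 => <-//.
congr normal_prob; apply/seteqP; split => u /=;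
  by rewrite !in_itv/= addr0 ler_pdivlMr// mulrC.
Qed.

Lemma Phi_nondecreasing : {homo @Phi R : a b / a <= b}.
Proof.
move=> a b ab; rewrite -lee_fin -!EFin_Phi.
apply: le_measure; rewrite ?inE//.
by move=> u /=; rewrite !in_itv/= => /le_trans; exact.
Qed.

(** The density never exceeds its peak. The bound yields the continuity of [Phi]. *)
Lemma Phi_lipschitz (a b : R) : a <= b ->
  Phi b <= Phi a + normal_peak 1 * (b - a).
Proof.
move=> ab; rewrite -lee_fin EFinD -!EFin_Phi.
have -> : `]-oo, b]%classic = `]-oo, a] `|` `]a, b] :> set (measurableTypeR R).
  by rewrite -itv_bndbnd_setU.
rewrite measureU//; last first.
  apply/seteqP; split => // u [] /=; rewrite !in_itv/= => ua /andP[].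
  by rewrite ltNge ua.
apply: leeD2l.
apply: (@le_trans _ _ (\int[lebesgue_measure]_(u in `]a, b]) (normal_peak 1)%:E)%E).
  apply: ge0_le_integral => //=.
  - by move=> u _; rewrite lee_fin normal_pdf_ge0.
  - by apply/measurable_funTS/measurable_EFinP; exact: measurable_normal_pdf.
  - by move=> u _; rewrite lee_fin normal_pdf_ub// oner_neq0.
rewrite integral_cst//= lebesgue_measure_itv/= lte_fin.
case: ifPn => // _.
by rewrite mule0 lee_fin mulr_ge0 ?normal_peak_ge0// subr_ge0.
Qed.

Lemma continuous_Phi : continuous (@Phi R).
Proof.
move=> a; apply/cvgrPdist_le => e e0.
have k0 : 0 < normal_peak (1 : R) by exact/normal_peak_gt0/oner_neq0.
near=> b.
have kab : normal_peak 1 * `|a - b| <= e.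
  rewrite -ler_pdivlMl//; near: b.
  by apply: cvgr_dist_le; [exact: cvg_id|rewrite mulr_gt0// invr_gt0].
have [ab|/ltW ba] := leP a b.
  rewrite ler0_norm ?subr_le0 ?Phi_nondecreasing// opprB lerBlDl.
  apply: (le_trans (Phi_lipschitz ab)); rewrite lerD2l.
  by move: kab; rewrite distrC ger0_norm// subr_ge0.
rewrite ger0_norm ?subr_ge0 ?Phi_nondecreasing// lerBlDl.
apply: (le_trans (Phi_lipschitz ba)); rewrite lerD2l.
by move: kab; rewrite ger0_norm// subr_ge0.
Unshelve. all: by end_near. Qed.

(** The limits of [Phi] at the two infinities give values on either side of [p], and the
    intermediate value theorem applies between them. *)
Lemma Phi_surj (p : R) : 0 < p < 1 -> exists a, Phi a = p.
Proof.
move=> /andP[p0 p1].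
(* The identity, as a random variable under the normal law, has [Phi] as its [cdf], so the general
   limits of a [cdf] become available. *)
pose id_R (u : measurableTypeR R) : R := u.
have mid_R : measurable_fun setT id_R by exact: measurable_id.
pose X : {RV (normal_prob (0 : R) 1) >-> R} :=
  HB.pack id_R (isMeasurableFun.Build _ _ _ _ id_R mid_R).
have cdfX t : cdf X t = (Phi t)%:E by exact: EFin_Phi.
have [b pb] : exists b, p < Phi b.
  have [M [_ Mp]] : \forall t \near +oo, (p%:E < cdf X t)%E.
    by apply: (cvg_cdfy1 X (open_ereal_gt' _)); rewrite lte_fin.
  (* The eventual bound holds for arguments strictly above [M], hence the witness [M + 1]. *)
  by exists (M + 1); rewrite -lte_fin -cdfX; apply: Mp; rewrite ltrDl.
have [a pa] : exists a, Phi a < p.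
  have [M [_ Mp]] : \forall t \near -oo, (cdf X t < p%:E)%E.
    by apply: (cvg_cdfNy0 X (open_ereal_lt' _)); rewrite lte_fin.
  by exists (M - 1); rewrite -lte_fin -cdfX; apply: Mp; rewrite gtrBl.
have ab : a <= b.
  rewrite leNgt; apply/negP => /ltW /Phi_nondecreasing.
  by rewrite leNgt (lt_trans pa pb).
have [|c _ <-] := @IVT R Phi a b p ab (continuous_subspaceT continuous_Phi).
  by rewrite (min_idPl _) ?(max_idPr _) ?Phi_nondecreasing// (ltW pa) (ltW pb).
by exists c.
Qed.

Lemma Phi_invK (p : R) : 0 < p < 1 -> Phi (Phi_inv p) = p.
Proof.
move=> /Phi_surj[a ap]; apply: pinvK; rewrite inE; by exists a.
Qed.

End standard_normal_cdf.

(** * Integration against a power measure, one coordinate at a time *)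

Section power_measure_integral.
Context {R : realType}.
Variable mu : {sigma_finite_measure set (measurableTypeR R) -> \bar R}.

Lemma measurable_rV_cons_section n (u : measurableTypeR R) :
  measurable_fun setT (fun v : 'rV[R]_n => rV_cons (u, v)).
Proof. exact: (measurableT_comp (@measurable_rV_cons R n) (pair1_measurable u)). Qed.

Lemma measurable_fun_rV_cons d (T : measurableType d) n (f : 'rV[R]_n.+1 -> T) :
  measurable_fun setT f -> measurable_fun setT (fun z => f (rV_cons z)).
Proof. by move=> mf; exact: (measurableT_comp mf (@measurable_rV_cons R n)). Qed.

Lemma ge0_integral_power_measureS n (f : 'rV[R]_n.+1 -> \bar R) :
  measurable_fun setT f -> (forall v, (0 <= f v)%E) ->
  (\int[power_measure mu n.+1]_v f v =
   \int[mu]_u \int[power_measure mu n]_v f (rV_cons (u, v)))%E.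
Proof.
move=> mf f0.
transitivity (\int[(mu \x power_measure mu n)%E]_z f (rV_cons z))%E.
  rewrite [LHS](@ge0_integral_pushforward _ _ _ _ _ _ (@measurable_rV_cons R n)
    (mu \x power_measure mu n)%E)//.
have mfc := measurable_fun_rV_cons mf.
exact: (fubini_tonelli1 _ mfc (fun z => f0 (rV_cons z))).
Qed.

Lemma measurable_fun_integral_power_measure n (f : 'rV[R]_n.+1 -> \bar R) :
  measurable_fun setT f -> (forall v, (0 <= f v)%E) ->
  measurable_fun setT
    (fun u : measurableTypeR R => \int[power_measure mu n]_v f (rV_cons (u, v)))%E.
Proof.
move=> mf f0; have mfc := measurable_fun_rV_cons mf.
exact: (measurable_fun_fubini_tonelli_F _ mfc).
Qed.

End power_measure_integral.

(** * The scalar product and the Euclidean norm on row vectors *)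

Section dot_product.
Context {R : realType}.

Definition dot n (u v : 'rV[R]_n) : R := \sum_(i < n) u ord0 i * v ord0 i.

Lemma rV_cons_uncons n (v : 'rV[R]_n.+1) : rV_cons (rV_uncons v) = v.
Proof.
apply/rowP => i; have [j ->|->] := unliftP ord0 i.
  by rewrite rV_consS /= mxE.
by rewrite rV_cons0.
Qed.

Lemma dot_rV_cons n (a b : R) (u v : 'rV[R]_n) :
  dot (rV_cons (a, u)) (rV_cons (b, v)) = a * b + dot u v.
Proof.
rewrite /dot big_ord_recl !rV_cons0; congr (_ + _).
by apply: eq_bigr => i _; rewrite !rV_consS.
Qed.

Lemma rV_consD n (a b : R) (u v : 'rV[R]_n) :
  rV_cons (a, u) + rV_cons (b, v) = rV_cons (a + b, u + v).
Proof.
apply/rowP => i; rewrite mxE; have [j ->|->] := unliftP ord0 i.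
  by rewrite !rV_consS /= mxE.
by rewrite !rV_cons0.
Qed.

Lemma dot_eq0 n (u : 'rV[R]_n) : dot u u = 0 -> u = 0.
Proof.
move=> /eqP; rewrite psumr_eq0 => [/allP u0|i _]; last by rewrite -expr2 sqr_ge0.
apply/rowP => i; rewrite mxE.
by have := u0 i (mem_index_enum i); rewrite mulf_eq0 orbb => /eqP.
Qed.

Lemma dotDr n (u v w : 'rV[R]_n) : dot u (v + w) = dot u v + dot u w.
Proof. by rewrite -big_split; apply: eq_bigr => i _; rewrite mxE mulrDr. Qed.

Lemma dot0l n (v : 'rV[R]_n) : dot 0 v = 0.
Proof. by rewrite /dot big1// => i _; rewrite mxE mul0r. Qed.

Lemma dotNl n (u v : 'rV[R]_n) : dot (- u) v = - dot u v.
Proof. by rewrite -sumrN; apply: eq_bigr => i _; rewrite mxE mulNr. Qed.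

Lemma l2norm_ge0 n (u : 'rV[R]_n) : 0 <= l2norm u.
Proof. exact: sqrtr_ge0. Qed.

Lemma sqr_l2norm n (u : 'rV[R]_n) : l2norm u ^+ 2 = dot u u.
Proof.
by rewrite sqr_sqrtr ?sumr_ge0// => i _; rewrite sqr_ge0.
Qed.

Lemma measurable_dot n (u : 'rV[R]_n) :
  measurable_fun setT (fun v => dot u v : measurableTypeR R).
Proof.
apply: measurable_sum => i; apply: measurable_funM => //.
exact: measurable_coord.
Qed.

Lemma measurable_rV_shift n (u : 'rV[R]_n) :
  measurable_fun setT (fun v : 'rV[R]_n => v + u).
Proof.
apply/measurable_fun_rVP => i; under eq_fun do rewrite mxE.
by apply: measurable_funD => //; exact: measurable_coord.
Qed.

End dot_product.

(** * Translation of the Gaussian measure on R^n *)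

Section gaussian.
Context {R : realType} (s : R).
Hypothesis s0 : s != 0.

Lemma ge0_integral_gaussianS n (f : 'rV[R]_n.+1 -> \bar R) :
  measurable_fun setT f -> (forall v, (0 <= f v)%E) ->
  (\int[gaussian s n.+1]_v f v =
   \int[normal_prob 0 s]_u \int[gaussian s n]_v f (rV_cons (u, v)))%E.
Proof. exact: ge0_integral_power_measureS. Qed.

(* The Cameron-Martin density of N(delta, s^2 I_n) with respect to
   N(0, s^2 I_n). *)
Definition cm_density n (delta v : 'rV[R]_n) : R :=
  expR ((dot delta v - dot delta delta / 2) / s ^+ 2).

Lemma measurable_cm_density n (delta : 'rV[R]_n) :
  measurable_fun setT (cm_density delta).
Proof.
apply: measurableT_comp => //; apply: measurable_funM => //.
apply: measurable_funB => //; exact: measurable_dot.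
Qed.

Lemma cm_density_rV_cons n (a u : R) (delta v : 'rV[R]_n) :
  cm_density (rV_cons (a, delta)) (rV_cons (u, v)) =
  expR ((a * u - a ^+ 2 / 2) / s ^+ 2) * cm_density delta v.
Proof.
rewrite /cm_density !dot_rV_cons -expRD; congr expR.
by field.
Qed.

(** Induction on the dimension: the density factors along [rV_cons], so the tail is translated by
    the induction hypothesis and the first coordinate by the one-dimensional formula. *)
Lemma ge0_integral_gaussian_shift n (delta : 'rV[R]_n) (f : 'rV[R]_n -> \bar R) :
  measurable_fun setT f -> (forall v, (0 <= f v)%E) ->
  (\int[gaussian s n]_v f (v + delta)%R =
   \int[gaussian s n]_v (f v * (cm_density delta v)%:E))%E.
Proof.
elim: n delta f => [|n IHn] delta f mf f0.
  apply: eq_integral => v _.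
  have -> : delta = 0 by apply/rowP => -[].
  by rewrite addr0 /cm_density !dot0l mul0r subrr mul0r expR0 mule1.
rewrite -(rV_cons_uncons delta); case: (rV_uncons delta) => a e {delta}.
have mcm m (e' : 'rV[R]_m) : measurable_fun setT (EFin \o cm_density e').
  by apply/measurable_EFinP; exact: measurable_cm_density.
have cm0 m (e' v : 'rV[R]_m) : (0 <= (cm_density e' v)%:E)%E.
  by rewrite lee_fin expR_ge0.
rewrite ge0_integral_gaussianS//; last first.
  exact: (measurableT_comp mf (measurable_rV_shift _)).
rewrite [RHS]ge0_integral_gaussianS; last 2 first.
- exact: (emeasurable_funM mf (mcm _ _)).
- by move=> v; rewrite mule_ge0.
(* [g] already carries the density for the tail; only the shift by [a] of the first coordinate
   remains to be absorbed. *)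
pose g (v : 'rV[R]_n.+1) : \bar R := (f v * (cm_density e (rV_uncons v).2)%:E)%E.
have g0 v : (0 <= g v)%E by rewrite mule_ge0.
have mg : measurable_fun setT g.
  apply: emeasurable_funM => //.
  apply: (measurableT_comp (mcm _ e)).
  exact: (measurableT_comp measurable_snd (@measurable_rV_uncons R n)).
pose F u := (\int[gaussian s n]_v g (rV_cons (u, v)))%E.
have F0 u : (0 <= F u)%E by apply: integral_ge0.
have mF : measurable_fun setT F by exact: measurable_fun_integral_power_measure.
transitivity (\int[normal_prob 0 s]_u F (u + a)%R)%E.
  apply: eq_integral => u _.
  transitivity (\int[gaussian s n]_v f (rV_cons (u + a, v + e)%R))%E.
    by apply: eq_integral => v _; rewrite rV_consD.
  have mfu : measurable_fun setT (fun v : 'rV[R]_n => f (rV_cons (u + a, v))).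
    exact: (measurableT_comp mf (measurable_rV_cons_section _)).
  rewrite [LHS](IHn e _ mfu (fun v => f0 _)).
  by apply: eq_integral => v _; rewrite /g rV_consK.
apply: etrans (ge0_integral_normal_prob_shift a s0 mF F0) _.
apply: eq_integral => u _.
rewrite -ge0_integralZr; last 4 first.
- exact: measurableT.
- exact: (measurableT_comp mg (measurable_rV_cons_section _)).
- by move=> v _; exact: g0.
- by rewrite lee_fin expR_ge0.
apply: eq_integral => v _; rewrite /g rV_consK/= cm_density_rV_cons.
by rewrite [in RHS]EFinM [in RHS](muleC (expR _)%:E) muleA.
Qed.

End gaussian.

(** * The law of a linear functional under the Gaussian measure *)

Section gaussian_laws.
Context {R : realType}.

(** Scaling by a negative factor produces a negative standard deviation parameter; the density sees
    only its square. *)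
Lemma normal_prob_sqr (m s t : R) : s != 0 -> s ^+ 2 = t ^+ 2 ->
  normal_prob m s = normal_prob m t.
Proof.
move=> s0 st; have t0 : t != 0 by rewrite -sqrf_eq0 -st sqrf_eq0.
apply/funext => A; apply: eq_integral => u _.
by rewrite !normal_pdfE// /normal_peak /normal_fun st.
Qed.

Lemma power_measure_section (mu : {sigma_finite_measure set (measurableTypeR R) -> \bar R})
    n (A : set 'rV[R]_n.+1) u : measurable A ->
  power_measure mu n [set v | A (rV_cons (u, v))] =
  (\int[power_measure mu n]_v (\1_A (rV_cons (u, v)))%:E)%E.
Proof.
move=> mA.
have mAu : measurable [set v | A (rV_cons (u, v))].
  by rewrite -[X in measurable X]setTI; exact: (measurable_rV_cons_section u).
rewrite -[in LHS](setIT [set v | A _]) -integral_indic; last 2 first.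
- exact: measurableT.
- exact: mAu.
by apply: eq_integral.
Qed.

Lemma power_measureSE (mu : {sigma_finite_measure set (measurableTypeR R) -> \bar R})
    n (A : set 'rV[R]_n.+1) : measurable A ->
  (power_measure mu n.+1 A =
   \int[mu]_u power_measure mu n [set v | A (rV_cons (u, v))])%E.
Proof.
move=> mA.
have m1A : measurable_fun setT (fun v => (\1_A v)%:E : \bar R).
  exact/measurable_EFinP/measurable_indic.
transitivity (\int[power_measure mu n.+1]_v (\1_A v)%:E)%E.
  by rewrite integral_indic// setIT.
rewrite ge0_integral_power_measureS; [|exact: m1A|by move=> v; rewrite lee_fin].
by apply: eq_integral => u _; rewrite power_measure_section.
Qed.

(** Induction on the dimension: given the first coordinate [u], the functional is normal with mean
    [a * u], and averaging over [u] is a mixture of normal laws. Fixing [q] by its square leaves its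
    sign free. *)
Lemma gaussian_dot (s q : R) n (delta : 'rV[R]_n) (A : set (measurableTypeR R)) :
  s != 0 -> q != 0 -> q ^+ 2 = s ^+ 2 * dot delta delta -> measurable A ->
  gaussian s n [set v | A (dot delta v)] = normal_prob 0 q A.
Proof.
move=> s0; elim: n delta q A => [|n IHn] delta q A q0 q2 mA.
  (* In dimension 0 the hypothesis on [q ^+ 2] forces [q = 0], a contradiction. *)
  have d0 : delta = 0 by apply/rowP => -[].
  by move: q2 q0; rewrite d0 dot0l mulr0 => /eqP; rewrite sqrf_eq0 => ->.
move: q2; rewrite -(rV_cons_uncons delta); case: (rV_uncons delta) => a e {delta}.
rewrite dot_rV_cons => q2.
have mdA : measurable [set v | A (dot (rV_cons (a, e)) v)].
  rewrite -[X in measurable X]setTI; exact: measurable_dot.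
rewrite [LHS](@power_measureSE (normal_prob 0 s) _ _ mdA).
have -> : (\int[normal_prob 0 s]_u power_measure (normal_prob 0 s) n
      [set v | [set w | A (dot (rV_cons (a, e)) w)] (rV_cons (u, v))] =
    \int[normal_prob 0 s]_u gaussian s n [set v | A (a * u + dot e v)%R])%E.
  apply: eq_integral => u _; congr power_measure.
  by apply/seteqP; split => v /=; rewrite dot_rV_cons.
(* If [e = 0], the tail contributes a point mass rather than a nondegenerate normal law, and the
   functional is [u] scaled by [a], which is then nonzero. *)
have [e0|e0] := eqVneq (dot e e) 0.
  have a0 : a != 0.
    apply: contra_neq q0 => a0; apply/eqP; rewrite -sqrf_eq0 q2 a0 e0.
    by rewrite mulr0 addr0 mulr0.
  transitivity (\int[normal_prob 0 s]_u (\1_A (a * u + 0)%R)%:E)%E.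
    apply: eq_integral => u _; rewrite (dot_eq0 e0).
    under eq_set do rewrite dot0l.
    have [Au|Au] := pselect (A (a * u + 0)).
      rewrite indicE mem_set// [X in gaussian _ _ X](_ : _ = setT).
        exact: (probability_setT (gaussian s n)).
      by apply/seteqP; split.
    rewrite indicE memNset// [X in gaussian _ _ X](_ : _ = set0) ?measure0//.
    by apply/seteqP; split.
  have m1A : measurable_fun setT (fun w : measurableTypeR R => (\1_A w)%:E : \bar R).
    exact/measurable_EFinP/measurable_indic.
  apply: etrans (ge0_integral_normal_prob_affine 0 0 s0 a0 m1A _) _.
    by move=> u; rewrite lee_fin.
  apply: etrans (esym (normal_probE _ _ mA)) _.
  rewrite mulr0 addr0 (@normal_prob_sqr 0 (a * s) q) ?mulf_neq0//.
  by rewrite q2 e0 addr0 exprMn mulrC expr2.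
(* [r] is the standard deviation of the tail part [dot e v]. *)
pose r := `|s| * l2norm e.
have r2 : r ^+ 2 = s ^+ 2 * dot e e by rewrite exprMn real_normK ?num_real// sqr_l2norm.
have r0 : r != 0 by rewrite -sqrf_eq0 r2 mulf_neq0// sqrf_eq0.
transitivity (\int[normal_prob 0 s]_u normal_prob (a * u + 0)%R r A)%E.
  apply: eq_integral => u _; rewrite addr0.
  have mAu : measurable ((fun w : measurableTypeR R => 1 * w + a * u) @^-1` A).
    by rewrite -[X in measurable X]setTI; exact: (measurable_affine 1 (a * u)).
  have := normal_prob_affine 0 (a * u) r0 (oner_neq0 R) mA.
  rewrite mulr0 add0r mul1r => <-.
  rewrite -(IHn e r _ r0 r2 mAu); congr gaussian.
  by apply/seteqP; split => v /=; rewrite mul1r addrC.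
(* If [a = 0], the mean does not depend on [u] and there is nothing to mix. *)
have [a0|a0] := eqVneq a 0.
  transitivity (\int[normal_prob 0 s]_u cst (normal_prob 0 r A) u)%E.
    by apply: eq_integral => u _; rewrite a0 mul0r addr0.
  rewrite integral_cst// [X in (_ * X)%E](_ : _ = 1%E); last exact: probability_setT.
  rewrite mule1 (@normal_prob_sqr 0 r q)//.
  by rewrite r2 q2 a0 mul0r add0r.
have as0 : a * s != 0 by rewrite mulf_neq0.
have mN := measurable_normal_prob r0 mA.
apply: etrans (ge0_integral_normal_prob_affine 0 0 s0 a0 mN _) _.
  by move=> u; rewrite measure_ge0.
rewrite mulr0 addr0; apply: etrans (normal_prob_mixture as0 r0 mA) _.
have pos : 0 < (a * s) ^+ 2 + r ^+ 2.
  by rewrite ltr_pwDl ?sqr_ge0// exprn_even_gt0.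
rewrite (@normal_prob_sqr 0 _ q)//; first by rewrite sqrtr_eq0 -ltNge.
by rewrite sqr_sqrtr ?ltW// q2 r2 exprMn; ring.
Qed.

End gaussian_laws.

(** * Null sets: from the Gaussian measure to Lebesgue measure *)

Section null_sets.
Context {R : realType}.

Lemma measurable_power_measure_section
    (mu : {sigma_finite_measure set (measurableTypeR R) -> \bar R})
    n (A : set 'rV[R]_n.+1) : measurable A ->
  measurable_fun setT
    (fun u : measurableTypeR R => power_measure mu n [set v | A (rV_cons (u, v))]).
Proof.
move=> mA; under eq_fun do rewrite power_measure_section//.
have m1A : measurable_fun setT (fun v => (\1_A v)%:E : \bar R).
  exact/measurable_EFinP/measurable_indic.
apply: (measurable_fun_integral_power_measure _ m1A).
by move=> v; rewrite lee_fin.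
Qed.

(** A set is null exactly when almost all its sections are, so absolute continuity passes from the
    factors to their powers by induction. *)
Lemma power_measure_null
    (mu nu : {sigma_finite_measure set (measurableTypeR R) -> \bar R}) :
  (forall A, measurable A -> nu A = 0%E -> mu A = 0%E) ->
  forall n (A : set 'rV[R]_n), measurable A ->
    power_measure nu n A = 0%E -> power_measure mu n A = 0%E.
Proof.
move=> numu; elim=> [|n IHn] A mA; first by [].
have ms (m : {sigma_finite_measure set (measurableTypeR R) -> \bar R}) :=
  measurable_power_measure_section m mA.
have msect u : measurable [set v | A (rV_cons (u, v))].
  by rewrite -[X in measurable X]setTI; exact: (measurable_rV_cons_section u).
have s_ge0 (m : {sigma_finite_measure set (measurableTypeR R) -> \bar R}) u :
    (0 <= power_measure m n [set v | A (rV_cons (u, v))])%E.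
  exact: measure_ge0.
rewrite (power_measureSE nu mA) => nuA0.
have : (\int[nu]_u `|power_measure nu n [set v | A (rV_cons (u, v))]| = 0)%E.
  by rewrite -[RHS]nuA0; apply: eq_integral => u _; rewrite gee0_abs.
move=> /(ae_eq_integral_abs nu measurableT (ms nu)) [N [mN nuN0 sN]].
rewrite (power_measureSE mu mA).
transitivity (\int[mu]_u `|power_measure mu n [set v | A (rV_cons (u, v))]|)%E.
  by apply: eq_integral => u _; rewrite gee0_abs.
apply/(ae_eq_integral_abs mu measurableT (ms mu)).
(* [N] contains every [u] whose section is not null for the power of [nu]; outside [N] the induction
   hypothesis applies to the section. *)
exists N; split; [exact: mN|exact: numu|].
apply: subset_trans sN; apply: subsetC => u /= nu0 _.
exact/IHn/nu0.
Qed.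

(** The density is positive everywhere, so its integral over [A] vanishes only if [A] is Lebesgue
    null. *)
Lemma normal_prob_null (m s : R) (A : set (measurableTypeR R)) : s != 0 ->
  measurable A -> normal_prob m s A = 0%E -> lebesgue_measure A = 0%E.
Proof.
move=> s0 mA N0.
have mpdf : measurable_fun A (EFin \o normal_pdf m s).
  by apply/measurable_funTS/measurable_EFinP; exact: measurable_normal_pdf.
have : (\int[lebesgue_measure]_(u in A) `|(normal_pdf m s u)%:E| = 0)%E.
  rewrite -[RHS]N0; apply: eq_integral => u _.
  by rewrite gee0_abs// lee_fin normal_pdf_ge0.
move=> /(ae_eq_integral_abs lebesgue_measure mA mpdf) [N [mN N00 sN]].
apply: (subset_measure0 mA mN _ N00) => u Au; apply: sN => /= /(_ Au)[].
rewrite normal_pdfE// => /eqP; rewrite mulf_eq0 !gt_eqF ?expR_gt0//.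
exact: normal_peak_gt0.
Qed.

Lemma gaussian_null (s : R) n (A : set 'rV[R]_n) : s != 0 -> measurable A ->
  gaussian s n A = 0%E -> lebesgue_rV n A = 0%E.
Proof.
move=> s0 mA; apply: (@power_measure_null lebesgue_measure (normal_prob 0 s)) => // B mB.
exact: normal_prob_null.
Qed.

(** By contraposition: a zero average makes [f] times the positive density [cm_density s x] vanish
    Gaussian almost everywhere, hence [f] vanishes Lebesgue almost everywhere. Moving the
    translation into the density leaves [f] evaluated at [v] itself. *)
Lemma gaussian_average_gt0 (s : R) n (f : 'rV[R]_n -> R) (x : 'rV[R]_n) :
  s != 0 -> measurable_fun setT f -> (forall v, 0 <= f v) ->
  ~ {ae lebesgue_rV n, forall v, f v = 0} ->
  (0 < \int[gaussian s n]_v (f (x + v)%R)%:E)%E.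
Proof.
move=> s0 mf f0; apply: contra_notT.
rewrite -leNgt => int_le0.
have mF : measurable_fun setT (EFin \o f) by exact/measurable_EFinP.
have mFL : measurable_fun setT (fun v => ((f v)%:E * (cm_density s x v)%:E)%E).
  apply: emeasurable_funM => //.
  by apply/measurable_EFinP; exact: measurable_cm_density.
have : (\int[gaussian s n]_v `|(f v)%:E * (cm_density s x v)%:E| = 0)%E.
  apply/eqP; rewrite eq_le; apply/andP; split; last exact: integral_ge0.
  apply: le_trans int_le0.
  have := ge0_integral_gaussian_shift s0 x mF (fun v => f0 v).
  rewrite /= => sh.
  under [leRHS]eq_integral do rewrite addrC.
  rewrite sh le_eqVlt; apply/orP; left; apply/eqP.
  by apply: eq_integral => v _; rewrite ger0_norm ?EFinM// mulr_ge0// expR_ge0.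
move=> /(ae_eq_integral_abs (gaussian s n) measurableT mFL) [N [mN N0 sN]].
exists N; split; [exact: mN|exact: gaussian_null N0|].
apply: subset_trans sN; apply: subsetC => v /= /(_ I) /eqP.
by rewrite mule_eq0 => /orP[/eqP[]//|]; rewrite eqe gt_eqF ?expR_gt0.
Qed.

End null_sets.

(** * The Neyman-Pearson comparison *)

Section neyman_pearson.
Context {R : realType} (s : R) (n : nat).
Hypothesis s_gt0 : 0 < s.
Let P := gaussian s n.
Let s0 : s != 0. Proof. exact: lt0r_neq0. Qed.

(** With L the Cameron-Martin density, integrating [(F - G) * (L - k) >= 0] gives E[(F - G) L] >= k
    E[F - G] >= 0, and averages against L are averages of translates. *)
Lemma neyman_pearson (delta : 'rV[R]_n) (k : R) (F G : 'rV[R]_n -> R) :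
  measurable_fun setT F -> measurable_fun setT G ->
  (forall v, 0 <= F v) -> (forall v, 0 <= G v <= 1) -> 0 <= k ->
  (forall v, 0 <= (F v - G v) * (cm_density s delta v - k)) ->
  (\int[P]_v (G v)%:E <= \int[P]_v (F v)%:E)%E ->
  (\int[P]_v (G (v + delta)%R)%:E <= \int[P]_v (F (v + delta)%R)%:E)%E.
Proof.
move=> mF mG F0 G01 k0 FGL GF.
have G0 v : 0 <= G v by have /andP[] := G01 v.
have L0 v : 0 <= cm_density s delta v by exact: expR_ge0.
have mL := measurable_cm_density s delta.
have mEF : measurable_fun setT (EFin \o F) by exact/measurable_EFinP.
have mEG : measurable_fun setT (EFin \o G) by exact/measurable_EFinP.
have mEL : measurable_fun setT (EFin \o cm_density s delta) by exact/measurable_EFinP.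
have mFL := emeasurable_funM mEF mEL.
have mGL := emeasurable_funM mEG mEL.
have mZ (H : 'rV[R]_n -> R) : measurable_fun setT (EFin \o H) ->
    measurable_fun setT (fun v => (k%:E * (H v)%:E)%E).
  by move=> mH; exact: (emeasurable_funM (measurable_cst _) mH).
have := ge0_integral_gaussian_shift s0 delta mEF (fun v => F0 v).
have := ge0_integral_gaussian_shift s0 delta mEG (fun v => G0 v).
rewrite /= -/P => -> ->.
have Gfin : (\int[P]_v (G v)%:E)%E \is a fin_num.
  rewrite ge0_fin_numE; last by apply: integral_ge0 => v _; rewrite lee_fin.
  apply: (@le_lt_trans _ _ (\int[P]_v (cst 1 v))%E).
    apply: ge0_le_integral => //.
    - by move=> v _; rewrite lee_fin.
    - by move=> v _; rewrite lee_fin; have /andP[] := G01 v.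
  rewrite integral_cst// mul1e; apply: (le_lt_trans (probability_le1 _ _)) => //.
  by rewrite ltry.
have kG : (k%:E * \int[P]_v (G v)%:E)%E \is a fin_num by rewrite fin_numM.
(* Adding [k] times the average of [G], finite since [G <= 1], to both sides leaves only sums of
   nonnegative integrals, so no subtraction of extended reals occurs. *)
rewrite -(leeD2rE _ _ kG).
have int_split (H K : 'rV[R]_n -> R) : (forall v, 0 <= H v) -> (forall v, 0 <= K v) ->
    measurable_fun setT (EFin \o H) -> measurable_fun setT (EFin \o K) ->
    (\int[P]_v ((H v)%:E * (cm_density s delta v)%:E) + k%:E * \int[P]_v (K v)%:E =
     \int[P]_v ((H v)%:E * (cm_density s delta v)%:E + k%:E * (K v)%:E))%E.
  move=> H0 K0 mH mK; rewrite ge0_integralD//.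
  - by rewrite ge0_integralZl// => v _; rewrite lee_fin.
  - by move=> v _; rewrite mule_ge0// lee_fin.
  - exact: emeasurable_funM.
  - by move=> v _; rewrite mule_ge0// lee_fin.
  - exact: mZ.
apply: (@le_trans _ _ (\int[P]_v ((G v)%:E * (cm_density s delta v)%:E) +
    k%:E * \int[P]_v (F v)%:E)%E).
  by apply: leeD2l; apply: lee_wpmul2l; rewrite ?lee_fin.
rewrite !int_split//; apply: ge0_le_integral => //.
- by move=> v _; rewrite adde_ge0// mule_ge0// lee_fin.
- exact: (emeasurable_funD mGL (mZ _ mEF)).
- exact: (emeasurable_funD mFL (mZ _ mEG)).
- move=> v _; rewrite -!EFinM -!EFinD lee_fin -subr_ge0.
  by apply: le_trans (FGL v) _; rewrite le_eqVlt; apply/orP; left; apply/eqP; ring.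
Qed.

End neyman_pearson.

(** * Half-spaces as extremal test functions *)

Section half_space.
Context {R : realType} (s : R) (n : nat).
Hypothesis s_gt0 : 0 < s.
Let s0 : s != 0. Proof. exact: lt0r_neq0. Qed.

Lemma gaussian_half_space (e : 'rV[R]_n) (b : R) : 0 < l2norm e ->
  (\int[gaussian s n]_v (\1_`]-oo, b] (dot e v))%:E =
   (Phi (b / (s * l2norm e)))%:E)%E.
Proof.
move=> e0; have q0 : 0 < s * l2norm e by rewrite mulr_gt0.
rewrite -normal_prob_ray//.
have mH : measurable [set v : 'rV[R]_n | `]-oo, b]%classic (dot e v)].
  by rewrite -[X in measurable X]setTI; exact: (measurable_dot e).
rewrite -(@gaussian_dot _ s _ n e)//; last 2 first.
- exact: lt0r_neq0.
- by rewrite exprMn sqr_l2norm.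
rewrite -[in RHS](setIT [set v | _ (dot e v)]) -integral_indic; last 2 first.
- exact: measurableT.
- exact: mH.
by apply: eq_integral.
Qed.

Lemma l2norm_eq0 (e : 'rV[R]_n) : l2norm e = 0 -> e = 0.
Proof. by move=> e0; apply: dot_eq0; rewrite -sqr_l2norm e0 expr0n. Qed.

Lemma l2normN (e : 'rV[R]_n) : l2norm (- e) = l2norm e.
Proof. by congr Num.sqrt; apply: eq_bigr => i _; rewrite mxE sqrrN. Qed.

Variables (F : 'rV[R]_n -> R) (x delta : 'rV[R]_n) (a : R).
Hypotheses (mF : measurable_fun setT F) (F01 : forall v, 0 <= F v <= 1).

Let F0 v : 0 <= F v. Proof. by have /andP[] := F01 v. Qed.
Let F1 v : F v <= 1. Proof. by have /andP[] := F01 v. Qed.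

Let mFx : measurable_fun setT (fun v => F (x + v)).
Proof.
under eq_fun do rewrite addrC.
exact: (measurableT_comp mF (measurable_rV_shift x)).
Qed.

Let m_half (e : 'rV[R]_n) b :
  measurable_fun setT (fun v => \1_`]-oo, b] (dot e v) : R).
Proof.
have mI : measurable_fun setT (\1_`]-oo, b] : measurableTypeR R -> R).
  by apply: measurable_indic; exact: measurable_itv.
exact: (measurableT_comp mI (measurable_dot e)).
Qed.

Let indic01 (A : set R) t : 0 <= (\1_A t : R) <= 1.
Proof. by rewrite indicE; case: (_ \in _); rewrite /= ?ler01 ?lexx. Qed.

(** The density grows with [dot delta v], so the half-space [dot delta v <= b] collects the points
    where it is smallest: among functions with average at least [Phi a], its indicator has the least
    average after the shift. *)
Lemma gaussian_average_shift_lower :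
  ((Phi a)%:E <= \int[gaussian s n]_v (F (x + v)%R)%:E)%E ->
  ((Phi (a - l2norm delta / s))%:E <=
   \int[gaussian s n]_v (F (x + delta + v)%R)%:E)%E.
Proof.
move=> aF; have [d0|d0] := eqVneq (l2norm delta) 0.
  by rewrite d0 mul0r subr0 (l2norm_eq0 d0) addr0.
have d_gt0 : 0 < l2norm delta by rewrite lt_def d0 l2norm_ge0.
(* [b] gives the half-space Gaussian measure [Phi a], and [k] is the value of the density on its
   boundary. The shift by [delta] lowers the threshold by [dot delta delta], that is, the argument
   of [Phi] by [l2norm delta / s]. *)
pose b := s * l2norm delta * a.
pose G v : R := \1_`]-oo, b] (dot delta v).
pose k := expR ((b - dot delta delta / 2) / s ^+ 2).
have := @neyman_pearson _ s n s_gt0 delta k (fun v => F (x + v)) G mFx (m_half _ _)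
  (fun v => F0 _) (fun v => indic01 _ _) (expR_ge0 _).
have -> : (\int[gaussian s n]_v (G v)%:E = (Phi a)%:E)%E.
  rewrite gaussian_half_space//; congr (Phi _)%:E.
  by rewrite /b; field; rewrite d0 s0.
have -> : (\int[gaussian s n]_v (G (v + delta)%R)%:E =
    (Phi (a - l2norm delta / s))%:E)%E.
  transitivity (\int[gaussian s n]_v
      (\1_`]-oo, (b - dot delta delta)] (dot delta v))%:E)%E.
    apply: eq_integral => v _; rewrite /G dotDr !indicE; congr ((nat_of_bool _)%:R%:E).
    by apply/idP/idP; rewrite !inE /= !in_itv/= lerBrDr.
  rewrite gaussian_half_space//; congr (Phi _)%:E.
  by rewrite -sqr_l2norm /b; field; rewrite d0 s0.
move=> NP; apply: le_trans (NP _ aF) _ => [v|]; last first.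
  rewrite le_eqVlt; apply/orP; left; apply/eqP; apply: eq_integral => v _.
  by rewrite -addrA (addrC v).
have s2 : 0 < (s ^+ 2)^-1 by rewrite invr_gt0 exprn_gt0.
rewrite /G /cm_density /k indicE.
have [vb|vb] := leP (dot delta v) b.
  rewrite mem_set/= ?in_itv//= mulr_le0// ?subr_le0//.
  by rewrite ler_expR ler_pM2r// lerD2r.
rewrite memNset/= ?in_itv/= -?ltNge//; last by apply/negP; rewrite -ltNge.
rewrite subr0 mulr_ge0// subr_ge0 ler_expR ler_pM2r// lerD2r.
exact: ltW.
Qed.

(** The mirror image: the half-space [dot delta v >= - b], written with [- delta], collects the
    points of largest density, and its indicator now dominates [F]. *)
Lemma gaussian_average_shift_upper :
  (\int[gaussian s n]_v (F (x + v)%R)%:E <= (Phi a)%:E)%E ->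
  (\int[gaussian s n]_v (F (x + delta + v)%R)%:E <=
   (Phi (a + l2norm delta / s))%:E)%E.
Proof.
move=> Fa; have [d0|d0] := eqVneq (l2norm delta) 0.
  by rewrite d0 mul0r addr0 (l2norm_eq0 d0) addr0.
have d_gt0 : 0 < l2norm (- delta) by rewrite l2normN lt_def d0 l2norm_ge0.
pose b := s * l2norm delta * a.
pose G v : R := \1_`]-oo, b] (dot (- delta) v).
pose k := expR ((- b - dot delta delta / 2) / s ^+ 2).
have := @neyman_pearson _ s n s_gt0 delta k G (fun v => F (x + v)) (m_half _ _) mFx
  (fun v => proj1 (andP (indic01 _ _))) (fun v => F01 _) (expR_ge0 _).
have -> : (\int[gaussian s n]_v (G v)%:E = (Phi a)%:E)%E.
  rewrite gaussian_half_space// l2normN; congr (Phi _)%:E.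
  by rewrite /b; field; rewrite d0 s0.
have -> : (\int[gaussian s n]_v (G (v + delta)%R)%:E =
    (Phi (a + l2norm delta / s))%:E)%E.
  transitivity (\int[gaussian s n]_v
      (\1_`]-oo, (b + dot delta delta)] (dot (- delta) v))%:E)%E.
    apply: eq_integral => v _; rewrite /G dotDr !indicE; congr ((nat_of_bool _)%:R%:E).
    by rewrite (dotNl delta delta); apply/idP/idP; rewrite !inE /= !in_itv/= lerBlDr.
  rewrite gaussian_half_space// l2normN; congr (Phi _)%:E.
  by rewrite -sqr_l2norm /b; field; rewrite d0 s0.
move=> NP; apply: (le_trans _ (NP _ Fa)) => [|v].
  rewrite le_eqVlt; apply/orP; left; apply/eqP; apply: eq_integral => v _.
  by rewrite -addrA (addrC v).
have s2 : 0 < (s ^+ 2)^-1 by rewrite invr_gt0 exprn_gt0.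
rewrite /G /cm_density /k indicE dotNl.
have [vb|vb] := leP (- dot delta v) b.
  rewrite mem_set/= ?in_itv//= mulr_ge0// ?subr_ge0//.
  by rewrite ler_expR ler_pM2r// lerD2r lerNl.
rewrite memNset/= ?in_itv/=; last by apply/negP; rewrite -ltNge.
rewrite sub0r mulr_le0// ?oppr_le0// subr_le0 ler_expR ler_pM2r// lerD2r.
by rewrite lerNr ltW.
Qed.

End half_space.

(** * The smoothed classifier: finiteness, affine images, strict bounds *)

Section smoothed.
Context {R : realType} (s : R) (d c : nat) (hbar : 'rV[R]_d -> 'rV[R]_c).
Hypotheses (s_gt0 : 0 < s) (hbar01 : unit_valued hbar) (mhbar : measurable_fun setT hbar).
Let h := smoothed s hbar.
Let P := gaussian s d.

Lemma measurable_entry i : measurable_fun setT (fun v => hbar v ord0 i).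
Proof. by have /measurable_fun_rVP := mhbar; exact. Qed.

Let hbar0 z i : 0 <= hbar z ord0 i. Proof. by have /andP[] := hbar01 z i. Qed.
Let hbar1 z i : hbar z ord0 i <= 1. Proof. by have /andP[] := hbar01 z i. Qed.

Let mhx (x : 'rV[R]_d) i : measurable_fun setT (fun v => hbar (x + v) ord0 i).
Proof.
under eq_fun do rewrite addrC.
exact: (measurableT_comp (measurable_entry i) (measurable_rV_shift x)).
Qed.

(** The average is at most 1, so [fine] in [smoothed] loses nothing. *)
Lemma smoothedE x i : (\int[P]_v (hbar (x + v)%R ord0 i)%:E = (h x ord0 i)%:E)%E.
Proof.
rewrite /h /smoothed mxE unlock fineK// ge0_fin_numE; last first.
  by apply: integral_ge0 => v _; rewrite lee_fin.
apply: (@le_lt_trans _ _ (\int[P]_v (cst 1 v))%E).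
  apply: ge0_le_integral => //.
  - by move=> v _; rewrite lee_fin.
  - exact/measurable_EFinP.
  - by move=> v _; rewrite lee_fin.
by rewrite integral_cst// mul1e (le_lt_trans (probability_le1 _ _))// ltry.
Qed.

Lemma smoothed_affine (a b : R) x i : 0 <= a -> 0 <= b ->
  (\int[P]_v (a * hbar (x + v)%R ord0 i + b)%:E = (a * h x ord0 i + b)%:E)%E.
Proof.
move=> a0 b0.
transitivity (\int[P]_v (a%:E * (hbar (x + v)%R ord0 i)%:E + (cst b%:E) v))%E.
  by apply: eq_integral => v _.
have mE : measurable_fun setT (fun v => (hbar (x + v) ord0 i)%:E).
  exact/measurable_EFinP.
rewrite ge0_integralD//; last 2 first.
- by move=> v _; rewrite mule_ge0// lee_fin.
- exact: (emeasurable_funM (measurable_cst _) mE).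
rewrite ge0_integralZl//; last by move=> v _; rewrite lee_fin.
rewrite integral_cst// [X in (_ + _ * X)%E](_ : _ = 1%E); last exact: probability_setT.
by rewrite mule1 smoothedE.
Qed.

Lemma smoothed_gt0 x i :
  ~ {ae lebesgue_rV d, forall z, hbar z ord0 i = 0} -> 0 < h x ord0 i.
Proof.
move=> ae0; rewrite -lte_fin -smoothedE.
apply: (@gaussian_average_gt0 _ s d (fun v => hbar v ord0 i)) => //.
- exact: lt0r_neq0.
- exact: measurable_entry.
Qed.

(** The complement [1 - hbar] has a positive average, and the two averages add up to 1. *)
Lemma smoothed_lt1 x i :
  ~ {ae lebesgue_rV d, forall z, hbar z ord0 i = 1} -> h x ord0 i < 1.
Proof.
move=> ae1.
have gt0 : (0 < \int[P]_v (1 - hbar (x + v)%R ord0 i)%:E)%E.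
  apply: (@gaussian_average_gt0 _ s d (fun v => 1 - hbar v ord0 i)).
  - exact: lt0r_neq0.
  - by apply: measurable_funB => //; exact: measurable_entry.
  - by move=> v; rewrite subr_ge0.
  - apply: contra_not ae1; apply: filterS => z /eqP.
    by rewrite subr_eq0 => /eqP.
rewrite -lte_fin -smoothedE.
have sum1 : (\int[P]_v (hbar (x + v)%R ord0 i)%:E +
    \int[P]_v (1 - hbar (x + v)%R ord0 i)%:E = 1)%E.
  rewrite -ge0_integralD//.
  - transitivity (\int[P]_v (cst 1 v))%E.
      by apply: eq_integral => v _; rewrite -EFinD addrC subrK.
    rewrite integral_cst// mul1e; exact: probability_setT.
  - by move=> v _; rewrite lee_fin.
  - exact/measurable_EFinP.
  - by move=> v _; rewrite lee_fin subr_ge0.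
  - by apply/measurable_EFinP; exact: measurable_funB.
by rewrite -[ltRHS]sum1 smoothedE lteDl.
Qed.

End smoothed.

(** * The certified radius of the mixed classifier *)

Theorem theorem5 (R : realType) (d c : nat) (sigma alpha : R)
    (g hbar : 'rV[R]_d -> 'rV[R]_c) (x : 'rV[R]_d) (y y' : 'I_c) :
  (1 <= d)%N -> (2 <= c)%N -> 0 < sigma ->
  unit_valued g -> unit_valued hbar -> measurable_fun setT hbar ->
  (forall i, ~ {ae lebesgue_rV d, forall z, hbar z ord0 i = 0}) ->
  (forall i, ~ {ae lebesgue_rV d, forall z, hbar z ord0 i = 1}) ->
  let h := smoothed sigma hbar in
  is_argmax predT (h x) y ->
  is_argmax (predC1 y) (h x) y' ->
  1 / 2 <= alpha <= 1 ->
  forall delta : 'rV[R]_d,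
    l2norm delta <= certified_radius sigma alpha h x y y' ->
    is_argmax predT (mixed alpha g h (x + delta)) y.
Proof.
move=> _ _ s_gt0 g01 hbar01 mhbar ae0 ae1 h [_ ymax] [y'y y'max].
move=> /andP[a_ge a_le1] delta le_radius.
have a0 : 0 < alpha by rewrite (lt_le_trans _ a_ge).
have h0 z i : 0 < h z ord0 i by exact: smoothed_gt0.
have h1 z i : h z ord0 i < 1 by exact: smoothed_lt1.
have alt1 t : 0 < t < 1 -> 0 < alpha * t < 1.
  move=> /andP[t0 t1]; rewrite mulr_gt0//=.
  by rewrite (le_lt_trans _ t1)// ler_piMl// ltW.
set p := alpha * h x ord0 y in le_radius.
set q := alpha * h x ord0 y' + 1 - alpha in le_radius.
(* Both arguments of [Phi_inv] lie in []0, 1[], where [Phi_invK] holds, and not in the range of its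
   default value. *)
have p01 : 0 < p < 1 by rewrite alt1// h0 h1.
have q01 : 0 < q < 1.
  (* [q] is [1 - alpha * (1 - h x ord0 y')]. *)
  have /andP[ah0 ah1] : 0 < alpha * (1 - h x ord0 y') < 1.
    by rewrite alt1// subr_gt0 h1/= gtrBl h0.
  by rewrite /q; apply/andP; split; lra.
(* The radius is half the gap between the two quantiles, in units of [sigma]: each quantile may move
   by [l2norm delta / sigma] before they cross. *)
have gap : Phi_inv q + l2norm delta / sigma <= Phi_inv p - l2norm delta / sigma.
  rewrite -lerBrDr -addrA -opprD lerBrDl -lerBrDr -mulr2n.
  move: le_radius; rewrite /certified_radius -/p -/q => le_radius.
  rewrite -mulr_natr mulrAC ler_pdivrMr//.
  by rewrite -ler_pdivlMr//; move: le_radius; rewrite mulrC mulrA mulrAC.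
have mh i := measurable_entry mhbar i.
(* Used with [b = 0] for the class [y] and with [b = 1 - alpha] for its competitors. *)
have affine01 (b : R) i v : 0 <= b <= 1 - alpha -> 0 <= alpha * hbar v ord0 i + b <= 1.
  move=> /andP[b0 b1]; have /andP[v0 v1] := hbar01 v i.
  have av0 : 0 <= alpha * hbar v ord0 i by rewrite mulr_ge0// ltW.
  have av1 : alpha * hbar v ord0 i <= alpha by rewrite ler_piMr// ltW.
  by apply/andP; split; lra.
have m_affine (b : R) i : measurable_fun setT (fun v => alpha * hbar v ord0 i + b).
  by apply: measurable_funD => //; exact: measurable_funM.
have b0 : 0 <= 1 - alpha by rewrite subr_ge0.
have low : Phi (Phi_inv p - l2norm delta / sigma) <= alpha * h (x + delta) ord0 y.
  have := @gaussian_average_shift_lower _ sigma d s_gt0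
    (fun v => alpha * hbar v ord0 y + 0) x delta (Phi_inv p) (m_affine 0 y)
    (fun v => affine01 0 y v _).
  rewrite !smoothed_affine// ?(ltW a0)// !addr0 !lee_fin Phi_invK//.
  by apply; rewrite ?lexx//= b0.
have up i : i != y -> alpha * h (x + delta) ord0 i + (1 - alpha) <=
    Phi (Phi_inv q + l2norm delta / sigma).
  move=> iy.
  have := @gaussian_average_shift_upper _ sigma d s_gt0
    (fun v => alpha * hbar v ord0 i + (1 - alpha)) x delta (Phi_inv q)
    (m_affine (1 - alpha) i) (fun v => affine01 (1 - alpha) i v _).
  rewrite !smoothed_affine// ?(ltW a0)// !lee_fin Phi_invK//; apply.
    by rewrite b0 lexx.
  rewrite /q -addrA lerD2r ler_pM2l//; exact: y'max.
split=> // i _; have [->//|iy] := eqVneq i y.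
rewrite [leLHS]mxE [leRHS]mxE.
(* Positivity comes from [h] alone, since [g] may vanish; it keeps [ln] away from its default value
   and lets the logarithms be compared through their arguments. *)
have arg_gt0 j : 0 < (1 - alpha) * g (x + delta) ord0 j + alpha * h (x + delta) ord0 j.
  by rewrite ltr_wpDl ?mulr_gt0// mulr_ge0//; have /andP[] := g01 (x + delta) j.
rewrite ler_ln ?posrE//.
have /andP[gy0 _] := g01 (x + delta) y.
have /andP[_ gi1] := g01 (x + delta) i.
have gi : (1 - alpha) * g (x + delta) ord0 i <= 1 - alpha by rewrite ler_piMr.
have gy : 0 <= (1 - alpha) * g (x + delta) ord0 y by rewrite mulr_ge0.
(* At [x + delta], [alpha * h_i + (1 - alpha) <= alpha * h_y]. The term of [g_i] is at most
   [1 - alpha] and that of [g_y] at least 0, which settles the comparison. *)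
have := le_trans (up i iy) (le_trans (Phi_nondecreasing gap) low).
by lra.
Qed.
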